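(* Let $w_1,w_2,w_3$ be any odd positive integers, let $n\ge 0$ be an integer and let $y_1,y_2\in\mathbb{Z}_p$. Then \begin{align*} &\sum_{k+l+m=n}\binom{n}{k,l,m}E_{k,q^{w_2w_3}}(w_1y_1)E_{l,q^{w_1w_3}}(w_2y_2)T_{m,q^{w_1w_2}}(w_3-1)\,w_1^{l+m}w_2^{k+m}w_3^{k+l}\\ =&\sum_{k+l+m=n}\binom{n}{k,l,m}E_{k,q^{w_2w_3}}(w_1y_1)E_{l,q^{w_1w_2}}(w_3y_2)T_{m,q^{w_1w_3}}(w_2-1)\,w_1^{l+m}w_3^{k+m}w_2^{k+l}\\ =&\sum_{k+l+m=n}\binom{n}{k,l,m}E_{k,q^{w_1w_3}}(w_2y_1)E_{l,q^{w_2w_3}}(w_1y_2)T_{m,q^{w_1w_2}}(w_3-1)\,w_2^{l+m}w_1^{k+m}w_3^{k+l}\\ =&\sum_{k+l+m=n}\binom{n}{k,l,m}E_{k,q^{w_1w_3}}(w_2y_1)E_{l,q^{w_1w_2}}(w_3y_2)T_{m,q^{w_2w_3}}(w_1-1)\,w_2^{l+m}w_3^{k+m}w_1^{k+l}\\ =&\sum_{k+l+m=n}\binom{n}{k,l,m}E_{k,q^{w_1w_2}}(w_3y_1)E_{l,q^{w_1w_3}}(w_2y_2)T_{m,q^{w_2w_3}}(w_1-1)\,w_3^{l+m}w_2^{k+m}w_1^{k+l}\\ =&\sum_{k+l+m=n}\binom{n}{k,l,m}E_{k,q^{w_1w_2}}(w_3y_1)E_{l,q^{w_2w_3}}(w_1y_2)T_{m,q^{w_1w_3}}(w_2-1)\,w_3^{l+m}w_1^{k+m}w_2^{k+l}.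 \end{align*}
   Context: Let $p$ be a fixed odd prime, $\mathbb{C}_p$ the completion of an algebraic closure of $\mathbb{Q}_p$ with absolute value normalized by $|p|_p=1/p$, and let $q\in\mathbb{C}_p$ be fixed with $|q-1|_p<p^{-1/(p-1)}$. For $r\in\mathbb{C}_p$ with $|r-1|_p<p^{-1/(p-1)}$ (in particular for $r=q^w$, $w$ a positive integer), the $r$-Euler polynomials $E_{n,r}(x)$ ($n\ge 0$) are the polynomials in $x$ defined by the generating function $$\frac{2}{re^{t}+1}e^{xt}=\sum_{n=0}^{\infty}E_{n,r}(x)\frac{t^n}{n!}.$$ For integers $k,N\ge 0$, the $r$-analogue of the alternating power sum is $T_{k,r}(N)=\sum_{i=0}^{N}(-1)^i i^k r^i$, with the convention $0^0=1$. Sums over $k+l+m=n$ run over all nonnegative integers $k,l,m$ with $k+l+m=n$, and $\binom{n}{k,l,m}=\frac{n!}{k!\,l!\,m!}$. *)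

(* Defs.v *)
From HB Require Import structures.
From mathcomp Require Import all_boot all_order all_algebra.
From mathcomp Require Import reals exp.

Set Implicit Arguments.
Unset Strict Implicit.
Unset Printing Implicit Defensive.

Import Order.TTheory GRing.Theory Num.Theory.
Local Open Scope ring_scope.

Definition nonarch_abs (R : realType) (K : fieldType) (v : K -> R) : Prop :=
  [/\ forall x, 0 <= v x,
      forall x, v x = 0 <-> x = 0,
      forall x y, v (x * y) = v x * v y
    & forall x y, v (x + y) <= Num.max (v x) (v y)].

Definition abs_complete (R : realType) (K : fieldType) (v : K -> R) : Prop :=
  forall u : nat -> K,
    (forall e : R, 0 < e -> exists N : nat, forall m n : nat,
       (N <= m)%N -> (N <= n)%N -> v (u m - u n) < e) ->
    exists l : K, forall e : R, 0 < e -> exists N : nat, forall n : nat,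
       (N <= n)%N -> v (u n - l) < e.

Definition is_completion (R : realType) (F K : fieldType)
    (vF : F -> R) (vK : K -> R) (f : {rmorphism F -> K}) : Prop :=
  [/\ nonarch_abs vK,
      forall x, vK (f x) = vF x,
      forall (y : K) (e : R), 0 < e -> exists x : F, vK (y - f x) < e
    & abs_complete vK].

Definition is_alg_closure (F K : fieldType) (f : {rmorphism F -> K}) : Prop :=
  GRing.closed_field_axiom K /\ forall x : K, algebraicOver f x.

(* |a / b|_p = p ^ (v_p(b) - v_p(a)), hence |p|_p = 1 / p. *)
Definition padic_abs (R : realType) (p : nat) (x : rat) : R :=
  if x == 0 then 0
  else p%:R ^+ logn p `|denq x|%N / p%:R ^+ logn p `|numq x|%N.

(* A choice of Q -> Q_p -> Qbar_p -> C_p: completion of Q for |.|_p, algebraic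
   closure with the extended absolute value, completion. These data are unique
   up to isometric isomorphism. *)
Record padic_tower (R : realType) (p : nat) := PadicTower {
  Qp : fieldType;
  Qpbar : fieldType;
  Cp : fieldType;
  Qp_abs : Qp -> R;
  Qpbar_abs : Qpbar -> R;
  Cp_abs : Cp -> R;
  rat_to_Qp : {rmorphism rat -> Qp};
  Qp_to_Qpbar : {rmorphism Qp -> Qpbar};
  Qpbar_to_Cp : {rmorphism Qpbar -> Cp};
  Qp_completion : is_completion (padic_abs R p) Qp_abs rat_to_Qp;
  Qpbar_alg_closure : is_alg_closure Qp_to_Qpbar;
  Qpbar_nonarch : nonarch_abs Qpbar_abs;
  Qpbar_abs_extends : forall x, Qpbar_abs (Qp_to_Qpbar x) = Qp_abs x;
  Cp_completion : is_completion Qpbar_abs Cp_abs Qpbar_to_Cp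
}.

Definition Qp_to_Cp (R : realType) (p : nat) (X : padic_tower R p)
  (x : Qp X) : Cp X := Qpbar_to_Cp X (Qp_to_Qpbar X x).

Definition is_Zp (R : realType) (p : nat) (X : padic_tower R p) (x : Qp X) :
  Prop := Qp_abs x <= 1.

Section FormalPowerSeries.
Variable A : comUnitRingType.
Implicit Types f g h : nat -> A.

Definition fps_const (c : A) : nat -> A := fun n => c *+ (n == 0%N).

Definition fps_add f g : nat -> A := fun n => f n + g n.

Definition fps_mul f g : nat -> A :=
  fun n => \sum_(i < n.+1) f i * g (n - i)%N.

(* The first n coefficients of 1 / f, obtained by solving f * g = 1. *)
Fixpoint fps_inv_seq f (n : nat) : seq A :=
  if n is m.+1 then
    let s := fps_inv_seq f m in
    rcons s ((f 0%N)^-1 * ((m == 0%N)%:R - \sum_(i < m) f (m - i)%N * s`_i))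
  else [::].

Definition fps_inv f : nat -> A := fun n => (fps_inv_seq f n.+1)`_n.

Lemma size_fps_inv_seq f n : size (fps_inv_seq f n) = n.
Proof. by elim: n => //= n IHn; rewrite size_rcons IHn. Qed.

Lemma nth_fps_inv_seq f n i : (i < n)%N -> (fps_inv_seq f n)`_i = fps_inv f i.
Proof.
elim: n => // n IHn; rewrite ltnS leq_eqVlt => /predU1P[-> //|lt_in].
by rewrite /= nth_rcons size_fps_inv_seq lt_in IHn.
Qed.

Lemma eq_fps_mul f f' g g' :
  f =1 f' -> g =1 g' -> fps_mul f g =1 fps_mul f' g'.
Proof. by move=> eqf eqg n; apply: eq_bigr => i _; rewrite eqf eqg. Qed.

Lemma fps_mulC f g : fps_mul f g =1 fps_mul g f.
Proof.
move=> n; rewrite /fps_mul (reindex_inj rev_ord_inj) /=.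
by apply: eq_bigr => i _; rewrite mulrC subSS subKn // -ltnS.
Qed.

Lemma fps_mulA f g h : fps_mul f (fps_mul g h) =1 fps_mul (fps_mul f g) h.
Proof.
move=> n; pose tr (u : nat -> A) := \poly_(i < n.+1) u i.
have trE u i : (i <= n)%N -> (tr u)`_i = u i by rewrite coef_poly ltnS => ->.
have trM u v i : (i <= n)%N -> fps_mul u v i = (tr u * tr v)`_i.
  move=> le_in; rewrite coefM; apply: eq_bigr => j _.
  by rewrite !trE ?(leq_trans (leq_subr _ _)) // (leq_trans _ le_in) // -ltnS.
transitivity ((tr f * (tr g * tr h))`_n).
  rewrite coefM; apply: eq_bigr => i _.
  by rewrite trE ?leq_ord // trM // leq_subr.
rewrite mulrA coefM; apply: eq_bigr => i _.
by rewrite trM ?leq_ord // trE // leq_subr.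
Qed.

Lemma fps_mul1 f : fps_mul f (fps_const 1) =1 f.
Proof.
move=> n; rewrite /fps_mul big_ord_recr /= subnn mulr1 big1 ?add0r // => i _.
by rewrite /fps_const subn_eq0 leqNgt ltn_ord mulr0n mulr0.
Qed.

Lemma fps_mulV f : f 0%N \is a GRing.unit ->
  fps_mul f (fps_inv f) =1 fps_const 1.
Proof.
move=> f0_unit n; rewrite fps_mulC /fps_mul big_ord_recr /= subnn.
rewrite {2}/fps_inv /= nth_rcons size_fps_inv_seq ltnn eqxx.
under eq_bigr => i _ do rewrite -(nth_fps_inv_seq f (ltn_ord i)) mulrC.
by rewrite [_^-1 * _]mulrC mulrVK // addrC subrK /fps_const.
Qed.

End FormalPowerSeries.

Section Euler.
Variable K : fieldType.

(* e^{at}, for a in K[x] *)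
Definition fps_exp (a : {poly K}) : nat -> {poly K} :=
  fun n => (n`!%:R)^-1 *: a ^+ n.

(* The series (2 / (r e^t + 1)) e^{xt} over K[x]; its denominator is invertible
   exactly when r + 1 != 0. *)
Definition euler_den (r : K) : nat -> {poly K} :=
  fps_add (fps_mul (fps_const r%:P) (fps_exp 1)) (fps_const 1).

Definition euler_series (r : K) : nat -> {poly K} :=
  fps_mul (fps_mul (fps_const 2) (fps_inv (euler_den r))) (fps_exp 'X).

Definition euler_poly (r : K) (n : nat) : {poly K} :=
  n`!%:R *: euler_series r n.

(* The defining relation (r e^t + 1) * \sum_n E_{n,r}(x) t^n / n! = 2 e^{xt}. *)
Lemma euler_poly_genfun (r : K) :
  [pchar K] =i pred0 -> r + 1 != 0 ->
  fps_mul (euler_den r) (fun n => (n`!%:R)^-1 *: euler_poly r n)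
    =1 fps_mul (fps_const 2) (fps_exp 'X).
Proof.
move=> charK0 r1_neq0.
have den_unit : euler_den r 0 \is a GRing.unit.
  rewrite /euler_den /fps_add /fps_mul big_ord1 /fps_const /fps_exp !mulr1n.
  rewrite /= subn0 expr0 invr1 scale1r mulr1 -polyC1 -polyCD.
  by rewrite poly_unitE size_polyC r1_neq0 coefC unitfE.
have serE n : (n`!%:R)^-1 *: euler_poly r n = euler_series r n.
  rewrite scalerA mulVf ?scale1r //.
  by rewrite ((pcharf0P K).1 charK0) -lt0n fact_gt0.
move=> n; rewrite (eq_fps_mul (frefl _) serE) fps_mulA.
apply: eq_fps_mul n => // n.
rewrite (eq_fps_mul (frefl _) (fps_mulC _ _)) fps_mulA.
by rewrite (eq_fps_mul (fps_mulV den_unit) (frefl _)) fps_mulC fps_mul1.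
Qed.

Definition alt_power_sum (k : nat) (r : K) (N : nat) : K :=
  \sum_(0 <= i < N.+1) (-1) ^+ i * i%:R ^+ k * r ^+ i.

Definition trinomial (n k l m : nat) : nat := n`! %/ (k`! * l`! * m`!).

Definition sum_klm (n : nat) (F : nat -> nat -> nat -> K) : K :=
  \sum_(k < n.+1) \sum_(l < n.+1) \sum_(m < n.+1 | (k + l + m == n)%N) F k l m.

End Euler.

(* Main.v *)
Require Import Defs.
From HB Require Import structures.
From mathcomp Require Import all_boot all_order all_algebra.
From mathcomp Require Import boolp reals exp.
From mathcomp Require Import ring.
Set Implicit Arguments.
Unset Strict Implicit.
Unset Printing Implicit Defensive.

Import Order.TTheory GRing.Theory Num.Theory.
Local Open Scope ring_scope.

(** Put [Q = q e^t] and [w = w1 w2 w3].  The exponential generating function of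
    the first sum is a product of three series: the two Euler factors are
    [2 e^(w y1 t) / (Q^(w2 w3) + 1)] and [2 e^(w y2 t) / (Q^(w1 w3) + 1)], and
    the power sums give the geometric sum [(Q^w + 1) / (Q^(w1 w2) + 1)], where
    [w3] odd fixes the sign.  The product is symmetric in [w1, w2, w3], and the
    six sums are its images under permutations.  The denominators have constant
    terms [q^s + 1] with [s] odd, which do not vanish since [|q - 1| < 1 = |2|]. *)

(** * Cancellation, linearity and dilation for products of formal power series *)

Section PowerSeries.
Variable A : comUnitRingType.
Implicit Types f g h : nat -> A.

Lemma fps_mul_comm : commutative (@fps_mul A).
Proof. by move=> f g; apply/funext/fps_mulC. Qed.

Lemma fps_mul_assoc : associative (@fps_mul A).
Proof. by move=> f g h; apply/funext/fps_mulA. Qed.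

Lemma fps_mulACA : interchange (@fps_mul A) (@fps_mul A).
Proof.
move=> f g h k; rewrite -!fps_mul_assoc; congr fps_mul.
by rewrite !fps_mul_assoc [fps_mul g h]fps_mul_comm.
Qed.

Lemma fps_mul_coef0 f g : fps_mul f g 0 = f 0%N * g 0%N.
Proof. by rewrite /fps_mul big_ord1. Qed.

(** Multiplication by [fps_inv f] undoes that by [f]; identities between quotients can thus be
    proved after clearing denominators. *)
Lemma fps_mulI f g h :
  f 0%N \is a GRing.unit -> fps_mul f g = fps_mul f h -> g = h.
Proof.
move=> fU eq_fg.
have fK k : fps_mul (fps_inv f) (fps_mul f k) = k.
  rewrite fps_mul_assoc [fps_mul _ f]fps_mul_comm (funext (fps_mulV fU)).
  by rewrite fps_mul_comm (funext (fps_mul1 _)).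
by rewrite -(fK g) eq_fg fK.
Qed.

Lemma fps_mul_addl f g h n :
  fps_mul (fun i => f i + g i) h n = fps_mul f h n + fps_mul g h n.
Proof. by rewrite -big_split; apply: eq_bigr => i _; rewrite mulrDl. Qed.

Lemma fps_mul_scalel c f g n :
  fps_mul (fun i => c * f i) g n = c * fps_mul f g n.
Proof. by rewrite mulr_sumr; apply: eq_bigr => i _; rewrite mulrA. Qed.

Lemma fps_mul_sumr (I : Type) (s : seq I) f (c : I -> A) (g : I -> nat -> A) n :
  fps_mul f (fun m => \sum_(i <- s) c i * g i m) n
    = \sum_(i <- s) c i * fps_mul f (g i) n.
Proof.
rewrite /fps_mul (eq_bigr _ (fun j _ => mulr_sumr _ _ _ _)) exchange_big /=.
apply: eq_bigr => i _; rewrite mulr_sumr; apply: eq_bigr => j _.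
by rewrite mulrCA.
Qed.

(* Substitution of [c t] for [t]. *)
Lemma fps_mul_dilate c f g n :
  fps_mul (fun i => f i * c ^+ i) (fun i => g i * c ^+ i) n
    = fps_mul f g n * c ^+ n.
Proof.
rewrite mulr_suml; apply: eq_bigr => i _.
by rewrite mulrACA -exprD subnKC // -ltnS.
Qed.

End PowerSeries.

Lemma horner_fps_mul (K : fieldType) (f g : nat -> {poly K}) x n :
  (fps_mul f g n).[x] = fps_mul (fun i => (f i).[x]) (fun i => (g i).[x]) n.
Proof. by rewrite horner_sum; apply: eq_bigr => i _; rewrite hornerM. Qed.

(** * Trinomial sums as coefficients of products of series *)

Section Sums.
Variable K : fieldType.
Implicit Types (f g h : nat -> K) (q x y : K).

(** The constraint determines m, which leaves the nested index ranges of a product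
    [fps_mul f (fps_mul g h)]. *)
Lemma sum_klmE n (F : nat -> nat -> nat -> K) :
  sum_klm n F
    = \sum_(k < n.+1) \sum_(l < (n - k).+1) F k l (n - k - l)%N.
Proof.
apply: eq_bigr => k _; have le_kn : (k <= n)%N by rewrite -ltnS.
rewrite (big_ord_widen n.+1 (fun l => F k l (n - k - l)%N)); last first.
  by rewrite ltnS leq_subr.
rewrite [RHS]big_mkcond; apply: eq_bigr => l _ /=.
(* For l <= n - k exactly one m meets the constraint, for larger l none does. *)
rewrite ltnS leq_subRL //; case: leqP => [le_kln | lt_nkl].
  have lt_m : (n - k - l < n.+1)%N by rewrite ltnS -subnDA leq_subr.
  rewrite (big_pred1 (Ordinal lt_m)) // => m; rewrite /= -val_eqE /=.
  by rewrite -subnDA -[RHS](eqn_add2l (k + l)) subnKC.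
rewrite big_pred0 // => m; apply/negbTE; rewrite gtn_eqF //.
exact: leq_trans lt_nkl (leq_addr _ _).
Qed.

Hypothesis charK0 : [pchar K] =i pred0.

Lemma natf_fact_neq0 n : n`!%:R != 0 :> K.
Proof. by rewrite ((pcharf0P K).1 charK0) -lt0n fact_gt0. Qed.

(** Since n! = C(n, k) C(n - k, l) k! l! m!, the integer division in [trinomial] is exact and so
    commutes with the cast to [K]. *)
Lemma trinomialE n k l : (k + l <= n)%N ->
  (trinomial n k l (n - k - l))%:R
    = n`!%:R / (k`!%:R * l`!%:R * (n - k - l)`!%:R) :> K.
Proof.
move=> le_kln; have le_kn := leq_trans (leq_addr _ _) le_kln.
have le_l : (l <= n - k)%N by rewrite leq_subRL.
have factE : (n`! = 'C(n, k) * 'C(n - k, l) * (k`! * l`! * (n - k - l)`!))%N.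
  rewrite -(bin_fact le_kn) -(bin_fact le_l).
  by rewrite -!mulnA; congr muln; rewrite mulnCA; congr muln; rewrite mulnCA mulnA.
rewrite /trinomial {1}factE mulnK ?muln_gt0 ?fact_gt0 // factE.
by rewrite -!natrM [in RHS]natrM mulfK // !natrM !mulf_neq0 ?natf_fact_neq0.
Qed.

Lemma sum_klm_trinomial n f g h :
  sum_klm n (fun k l m => (trinomial n k l m)%:R * (f k * g l * h m))
    = n`!%:R * fps_mul (fun k => f k / k`!%:R)
        (fps_mul (fun l => g l / l`!%:R) (fun m => h m / m`!%:R)) n.
Proof.
rewrite sum_klmE mulr_sumr; apply: eq_bigr => k _.
rewrite !mulr_sumr; apply: eq_bigr => l _ /=.
have le_kn : (k <= n)%N by rewrite -ltnS.
rewrite trinomialE -?leq_subRL -1?ltnS //.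
have [k0 l0 m0] := And3 (natf_fact_neq0 k) (natf_fact_neq0 l)
  (natf_fact_neq0 (n - k - l)).
by field; rewrite k0 l0 m0.
Qed.

(** * Generating functions of the Euler polynomials and of the power sums *)

Definition exps x n : K := x ^+ n / n`!%:R.

Lemma exps_mul x y : fps_mul (exps x) (exps y) = exps (x + y).
Proof.
apply/funext => n; rewrite /exps addrC exprDn mulr_suml.
apply: eq_bigr => i _; have le_in : (i <= n)%N by rewrite -ltnS.
have := congr1 (fun m : nat => m%:R : K) (bin_fact le_in).
rewrite -mulr_natr !natrM => <-.
have [i0 ni0] := (natf_fact_neq0 i, natf_fact_neq0 (n - i)).
have C0 : 'C(n, i)%:R != 0 :> K.
  by rewrite ((pcharf0P K).1 charK0) -lt0n bin_gt0.
by field; rewrite i0 ni0 C0.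
Qed.

(* The series [q^s e^(s t) + 1]. *)
Definition exp_den q s n : K := q ^+ s * exps s%:R n + fps_const 1 n.

Lemma exp_den_mul q s f n :
  fps_mul (exp_den q s) f n = q ^+ s * fps_mul (exps s%:R) f n + f n.
Proof.
by rewrite fps_mul_addl fps_mul_scalel [fps_mul (fps_const _) _]fps_mul_comm
  fps_mul1.
Qed.

Lemma exp_den0 q s : exp_den q s 0 = q ^+ s + 1.
Proof. by rewrite /exp_den /exps /fps_const expr0 fact0 divr1 mulr1. Qed.

(** This is the defining relation of the Euler polynomials for r = q^s, evaluated at x, with s t
    substituted for t. *)
Lemma euler_poly_den q s x : q ^+ s + 1 != 0 ->
  fps_mul (exp_den q s)
      (fun k => (euler_poly (q ^+ s) k).[x] * s%:R ^+ k / k`!%:R)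
    = fun n => 2 * exps (s%:R * x) n.
Proof.
move=> qs1; apply/funext => n.
have := congr1 (fun u : {poly K} => u.[x] * s%:R ^+ n)
  (euler_poly_genfun charK0 qs1 n).
rewrite /= !horner_fps_mul -fps_mul_dilate /fps_mul => genE.
transitivity (\sum_(i < n.+1) (euler_den (q ^+ s) i).[x] * s%:R ^+ i *
   (((n - i)`!%:R^-1 *: euler_poly (q ^+ s) (n - i)).[x] * s%:R ^+ (n - i))).
  apply: eq_bigr => i _; rewrite [in RHS]hornerZ; congr (_ * _); last by ring.
  rewrite /exp_den /euler_den /fps_add hornerD mulrDl; congr (_ + _).
    (* With the constant series as second factor, only the last term of the Cauchy product
       survives. *)
    rewrite fps_mulC /fps_mul big_ord_recr /= subnn.
    rewrite big1 => [|j _]; last first.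
      by rewrite /fps_const subn_eq0 leqNgt ltn_ord mulr0n mulr0.
    rewrite add0r /fps_const mulr1n /fps_exp expr1n /exps -polyC1.
    rewrite hornerM hornerZ !hornerC mulr1.
    by ring.
  rewrite /fps_const; case: (nat_of_ord i) => [|j] /=.
    by rewrite !mulr1n -polyC1 hornerC mulr1.
  by rewrite !mulr0n horner0 mul0r.
rewrite genE; rewrite big_ord_recl big1 => [|j _]; last first.
  by rewrite /fps_const /= mulr0n horner0 mul0r.
rewrite addr0 subn0 /fps_const mulr1n /fps_exp /exps exprMn.
rewrite hornerZ hornerXn -[2]/(2%:R) -polyC_natr hornerC.
by ring.
Qed.

(** With Q = q e^t, the power sums generate the geometric sum of (-Q^s)^i over i < c. Multiplied by
    Q^s + 1 it telescopes to 1 - (-Q^s)^c, which is Q^(s c) + 1 for odd c. *)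
Lemma alt_power_sum_den q s c : odd c ->
  fps_mul (exp_den q s)
      (fun m => alt_power_sum m (q ^+ s) (c - 1)%N * s%:R ^+ m / m`!%:R)
    = exp_den q (s * c).
Proof.
move=> c_odd; have c_gt0 : (0 < c)%N by case: c c_odd.
(* The coefficient of t^m in e^(i s t) is (i s)^m / m!. As c > 0, the truncated bound c - 1 gives
   exactly the indices i < c. *)
have -> : (fun m => alt_power_sum m (q ^+ s) (c - 1)%N * s%:R ^+ m / m`!%:R)
    = fun m => \sum_(0 <= i < c) (- q ^+ s) ^+ i * exps (i * s)%:R m.
  apply/funext => m; rewrite /alt_power_sum subn1 prednK // !mulr_suml.
  apply: eq_bigr => i _; rewrite /exps natrM exprMn.
  by rewrite [(- q ^+ s) ^+ i]exprNn; ring.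
apply/funext => n; rewrite exp_den_mul fps_mul_sumr.
(* The sign is chosen so that [u i.+1 - u i] is the i-th term of the product. *)
pose u i := - ((- q ^+ s) ^+ i * exps (i * s)%:R n).
transitivity (\sum_(0 <= i < c) (u i.+1 - u i)).
  rewrite mulr_sumr -big_split; apply: eq_bigr => i _ /=.
  by rewrite exps_mul -natrD -mulSn /u opprK exprS; ring.
rewrite telescope_sumr // /u mul0n mul1r mulnC opprK exprNn.
rewrite -signr_odd c_odd expr1 mulN1r mulNr opprK -exprM mulnC; congr (_ + _).
(* The boundary term at i = 0 is e^(0 t), the constant series 1, by 0^0 = 1. *)
by rewrite /exps /fps_const; case: (n) => [|m]; rewrite ?divr1 // expr0n mul0r.
Qed.

(** * Symmetry of the sums under permutations of the weights *)

Definition euler_sum q y1 y2 n (a b c : nat) : K :=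
  sum_klm n (fun k l m => (trinomial n k l m)%:R
    * (euler_poly (q ^+ (b * c)) k).[a%:R * y1]
    * (euler_poly (q ^+ (a * c)) l).[b%:R * y2]
    * alt_power_sum m (q ^+ (a * b)) (c - 1)%N
    * a%:R ^+ (l + m) * b%:R ^+ (k + m) * c%:R ^+ (k + l)).

(** The weights a^(l+m) b^(k+m) c^(k+l) regroup as (b c)^k (a c)^l (a b)^m, so each factor is
    dilated by the exponent of its own power of q. *)
Definition euler_sum_series q y1 y2 (a b c : nat) : nat -> K :=
  fps_mul
    (fun k => (euler_poly (q ^+ (b * c)) k).[a%:R * y1]
                * (b * c)%:R ^+ k / k`!%:R)
    (fps_mul
      (fun l => (euler_poly (q ^+ (a * c)) l).[b%:R * y2]
                  * (a * c)%:R ^+ l / l`!%:R)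
      (fun m => alt_power_sum m (q ^+ (a * b)) (c - 1)%N
                  * (a * b)%:R ^+ m / m`!%:R)).

Lemma euler_sumE q y1 y2 n a b c :
  euler_sum q y1 y2 n a b c = n`!%:R * euler_sum_series q y1 y2 a b c n.
Proof.
rewrite -sum_klm_trinomial; apply: eq_bigr => k _; apply: eq_bigr => l _.
by apply: eq_bigr => m _; rewrite !natrM !exprMn !exprD; ring.
Qed.

(** The last factor is the denominator of the geometric sum; with it the product is symmetric in a,
    b, c. *)
Definition euler_sum_den q (a b c : nat) : nat -> K :=
  fps_mul (exp_den q (b * c)) (fps_mul (exp_den q (a * c)) (exp_den q (a * b))).

(** Each denominator clears one factor of the series, and the result depends on a, b, c only through
    their product. *)
Lemma euler_sum_denP q y1 y2 a b c : odd a -> odd b -> odd c ->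
  (forall s, odd s -> q ^+ s + 1 != 0) ->
  fps_mul (euler_sum_den q a b c) (euler_sum_series q y1 y2 a b c)
    = fps_mul (fun n => 2 * exps ((a * b * c)%:R * y1) n)
        (fps_mul (fun n => 2 * exps ((a * b * c)%:R * y2) n)
                 (exp_den q (a * b * c))).
Proof.
move=> ao bo co q1; rewrite /euler_sum_den /euler_sum_series.
(* Two interchanges pair every denominator with its own factor. *)
rewrite fps_mulACA [in X in fps_mul _ X]fps_mulACA.
rewrite !euler_poly_den ?alt_power_sum_den ?q1 ?oddM ?ao ?bo ?co //.
have -> : (b * c)%:R * (a%:R * y1) = (a * b * c)%:R * y1.
  by rewrite !natrM; ring.
have -> : (a * c)%:R * (b%:R * y2) = (a * b * c)%:R * y2.
  by rewrite !natrM; ring.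
by [].
Qed.

(** These two transpositions generate all permutations of a, b, c. The symmetric denominator
    cancels, its constant term being a product of nonzero q^s + 1 with s odd. *)
Lemma euler_sum_symmetric q y1 y2 n a b c : odd a -> odd b -> odd c ->
  (forall s, odd s -> q ^+ s + 1 != 0) ->
  euler_sum q y1 y2 n a b c = euler_sum q y1 y2 n b a c /\
  euler_sum q y1 y2 n a b c = euler_sum q y1 y2 n a c b.
Proof.
move=> ao bo co q1.
have denU : euler_sum_den q a b c 0%N \is a GRing.unit.
  by rewrite /euler_sum_den !fps_mul_coef0 !exp_den0 unitfE !mulf_neq0 // q1
    // oddM ?ao ?bo ?co.
have denC : euler_sum_den q a b c = euler_sum_den q b a c.
  rewrite /euler_sum_den !fps_mul_assoc [in RHS](mulnC b a).
  by rewrite [in LHS](fps_mul_comm (exp_den q (b * c))).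
have denAC : euler_sum_den q a b c = euler_sum_den q a c b.
  rewrite /euler_sum_den (mulnC c b).
  by rewrite [in LHS](fps_mul_comm (exp_den q (a * c))).
split; rewrite !euler_sumE; congr (_ * _ n); apply: fps_mulI denU _.
  by rewrite [in RHS]denC !euler_sum_denP // (mulnC a b).
by rewrite [in RHS]denAC !euler_sum_denP // (mulnAC a b c).
Qed.

End Sums.

(** * Nonvanishing of x^n + 1 for x near 1 *)

Section NonArchimedean.
Variables (R : realType) (K : fieldType) (v : K -> R).
Hypothesis vP : nonarch_abs v.

Lemma nonarch_abs1 : v 1 = 1.
Proof.
case: vP => _ v0 vM _; have v1_neq0 : v 1 != 0.
  by apply/eqP => /v0/eqP; rewrite oner_eq0.
by apply: (mulfI v1_neq0); rewrite -vM !mulr1.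
Qed.

Lemma nonarch_absN x : v (- x) = v x.
Proof.
case: vP => v_ge0 _ vM _; suff vN1 : v (-1) = 1 by rewrite -mulN1r vM vN1 mul1r.
apply/eqP; rewrite -(@eqrXn2 _ 2) ?ler01 //.
by rewrite expr2 -vM mulrNN mulr1 nonarch_abs1 expr1n.
Qed.

(** Induction through x^(n+1) - 1 = x (x^n - 1) + (x - 1), where v x <= 1 because x = (x - 1) +
    1. *)
Lemma nonarch_abs_expB1 x n : v (x - 1) < 1 -> v (x ^+ n - 1) < 1.
Proof.
case: vP => v_ge0 v0 vM vD x1.
have vx : v x <= 1.
  rewrite -(subrK 1 x); apply: le_trans (vD _ _) _.
  by rewrite ge_max (ltW x1) nonarch_abs1 lexx.
elim: n => [|n IHn]; first by rewrite subrr (v0 0).2.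
have -> : x ^+ n.+1 - 1 = x * (x ^+ n - 1) + (x - 1) by rewrite exprS; ring.
apply: le_lt_trans (vD _ _) _; rewrite gt_max x1 andbT vM.
by apply: le_lt_trans IHn; rewrite ler_piMl.
Qed.

(** If x^n were -1, then x^n - 1 = -2 would have absolute value 1, not less. *)
Lemma nonarch_abs_expD1_neq0 x n : v 2 = 1 -> v (x - 1) < 1 -> x ^+ n + 1 != 0.
Proof.
move=> v2 x1; apply/eqP => xn1; have := nonarch_abs_expB1 n x1.
have -> : x ^+ n - 1 = x ^+ n + 1 - 2 by ring.
by rewrite xn1 sub0r nonarch_absN v2 ltxx.
Qed.

End NonArchimedean.

(** An odd prime does not divide 2, so both valuations are zero. *)
Lemma padic_abs2 (R : realType) p : odd p -> prime p -> padic_abs R p 2 = 1.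
Proof.
move=> p_odd p_prime; rewrite /padic_abs.
have -> : (2 : rat) = (2 : int)%:Q by [].
rewrite intr_eq0 numq_int denq_int /= logn1.
rewrite lognE p_prime /= dvdn_prime2 //.
by case: eqP p_odd => [-> //|_ _]; rewrite expr0 divr1.
Qed.

(** * Characteristic of C_p and its absolute value on the rationals *)

Section Tower.
Variables (R : realType) (p : nat) (X : padic_tower R p).

Lemma Cp_pchar0 : [pchar (Cp X)] =i pred0.
Proof.
move=> l; rewrite -(pchar_num rat l) (fmorph_pchar (Qpbar_to_Cp X)).
by rewrite (fmorph_pchar (Qp_to_Qpbar X)) (fmorph_pchar (rat_to_Qp X)).
Qed.

Lemma Cp_abs_rat x :
  Cp_abs (Qpbar_to_Cp X (Qp_to_Qpbar X (rat_to_Qp X x))) = padic_abs R p x.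
Proof.
case: (Cp_completion X) => _ -> _ _; rewrite Qpbar_abs_extends.
by case: (Qp_completion X) => _ -> _ _.
Qed.

End Tower.

Theorem theorem4p2 (R : realType) (p : nat) (p_prime : prime p) (p_odd : odd p)
  (X : padic_tower R p) (q : Cp X)
  (q_near1 : Cp_abs (q - 1) < p%:R `^ (- (p%:R - 1)^-1))
  (w1 w2 w3 : nat) (w1_odd : odd w1) (w2_odd : odd w2) (w3_odd : odd w3)
  (n : nat) (y1 y2 : Qp X) (y1_int : is_Zp y1) (y2_int : is_Zp y2) :
  let E k r x := (euler_poly r k).[x] in
  let T := @alt_power_sum (Cp X) in
  let Y1 := Qp_to_Cp y1 in
  let Y2 := Qp_to_Cp y2 in
  let S1 := sum_klm n (fun k l m => (trinomial n k l m)%:R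
    * E k (q ^+ (w2 * w3)) (w1%:R * Y1) * E l (q ^+ (w1 * w3)) (w2%:R * Y2)
    * T m (q ^+ (w1 * w2)) (w3 - 1)%N
    * w1%:R ^+ (l + m) * w2%:R ^+ (k + m) * w3%:R ^+ (k + l)) in
  let S2 := sum_klm n (fun k l m => (trinomial n k l m)%:R
    * E k (q ^+ (w2 * w3)) (w1%:R * Y1) * E l (q ^+ (w1 * w2)) (w3%:R * Y2)
    * T m (q ^+ (w1 * w3)) (w2 - 1)%N
    * w1%:R ^+ (l + m) * w3%:R ^+ (k + m) * w2%:R ^+ (k + l)) in
  let S3 := sum_klm n (fun k l m => (trinomial n k l m)%:R
    * E k (q ^+ (w1 * w3)) (w2%:R * Y1) * E l (q ^+ (w2 * w3)) (w1%:R * Y2)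
    * T m (q ^+ (w1 * w2)) (w3 - 1)%N
    * w2%:R ^+ (l + m) * w1%:R ^+ (k + m) * w3%:R ^+ (k + l)) in
  let S4 := sum_klm n (fun k l m => (trinomial n k l m)%:R
    * E k (q ^+ (w1 * w3)) (w2%:R * Y1) * E l (q ^+ (w1 * w2)) (w3%:R * Y2)
    * T m (q ^+ (w2 * w3)) (w1 - 1)%N
    * w2%:R ^+ (l + m) * w3%:R ^+ (k + m) * w1%:R ^+ (k + l)) in
  let S5 := sum_klm n (fun k l m => (trinomial n k l m)%:R
    * E k (q ^+ (w1 * w2)) (w3%:R * Y1) * E l (q ^+ (w1 * w3)) (w2%:R * Y2)
    * T m (q ^+ (w2 * w3)) (w1 - 1)%N
    * w3%:R ^+ (l + m) * w2%:R ^+ (k + m) * w1%:R ^+ (k + l)) in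
  let S6 := sum_klm n (fun k l m => (trinomial n k l m)%:R
    * E k (q ^+ (w1 * w2)) (w3%:R * Y1) * E l (q ^+ (w2 * w3)) (w1%:R * Y2)
    * T m (q ^+ (w1 * w3)) (w2 - 1)%N
    * w3%:R ^+ (l + m) * w1%:R ^+ (k + m) * w2%:R ^+ (k + l)) in
  [/\ S1 = S2, S2 = S3, S3 = S4, S4 = S5 & S5 = S6].
Proof.
move=> E T Y1 Y2 S1 S2 S3 S4 S5 S6.
have [vP _ _ _] := Cp_completion X.
have q1 : Cp_abs (q - 1) < 1.
  (* The radius p^(-1/(p-1)) is at most p^0 = 1. *)
  apply: lt_le_trans q_near1 _.
  have p_gt1 : 1 < p%:R :> R by rewrite ltr1n prime_gt1.
  rewrite -[leRHS](powRr0 p%:R) ler_powR ?(ltW p_gt1) // oppr_le0 invr_ge0.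
  by rewrite subr_ge0 ltW.
have qD1 s : odd s -> q ^+ s + 1 != 0.
  move=> _; apply: (nonarch_abs_expD1_neq0 vP) => //.
  (* The embeddings fix integers, so |2| = 1 carries over from the rationals. *)
  by have := Cp_abs_rat X 2; rewrite !rmorph_nat padic_abs2.
have sym := fun a b c => @euler_sum_symmetric _ (Cp_pchar0 X) q Y1 Y2 n a b c.
(* Each sum is [euler_sum] at a permutation of the weights, up to the order of factors in the
   exponents of q. *)
have -> : S1 = euler_sum q Y1 Y2 n w1 w2 w3 by [].
have -> : S2 = euler_sum q Y1 Y2 n w1 w3 w2.
  by rewrite /S2 (mulnC w2 w3).
have -> : S3 = euler_sum q Y1 Y2 n w2 w1 w3.
  by rewrite /S3 (mulnC w1 w2).
have -> : S4 = euler_sum q Y1 Y2 n w2 w3 w1.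
  by rewrite /S4 (mulnC w1 w3) (mulnC w1 w2).
have -> : S5 = euler_sum q Y1 Y2 n w3 w2 w1.
  by rewrite /S5 (mulnC w1 w3) (mulnC w1 w2) (mulnC w2 w3).
have -> : S6 = euler_sum q Y1 Y2 n w3 w1 w2.
  by rewrite /S6 (mulnC w1 w3) (mulnC w2 w3).
have {}sym a b c ao bo co := sym a b c ao bo co qD1.
(* Consecutive sums differ by one adjacent transposition, except the second and third, which are
   each one transposition away from the first. *)
split.
- by case: (sym w1 w2 w3).
- by case: (sym w1 w2 w3) => // <- ->.
- by case: (sym w2 w1 w3).
- by case: (sym w2 w3 w1).
- by case: (sym w3 w2 w1).
Qed.
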